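(* For every integer $n\ge15$, there exists a cubic totally silver graph of order $4n$ and girth $9$.
   Context: A totally silver coloring of a graph $G$ is a map $c$ from $V(G)$ to a set of colors such that for every $v\in V(G)$, each color appears exactly once on the closed neighborhood $N[v]$; a graph is totally silver if it admits one. Cubic means $3$--regular; girth is the length of a shortest cycle. *)

(* Defs.v *)
From mathcomp Require Import all_boot.

Set Implicit Arguments.
Unset Strict Implicit.
Unset Printing Implicit Defensive.

Record sgraph := SGraph {
  vertex :> finType;
  adj : rel vertex;
  adj_sym : symmetric adj;
  adj_irrefl : irreflexive adj }.

Definition graph_order (G : sgraph) : nat := #|G|.

Definition open_nbhd (G : sgraph) (v : G) : {set G} := [set u | adj v u].

Definition closed_nbhd (G : sgraph) (v : G) : {set G} := v |: open_nbhd v.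

Definition regular (k : nat) (G : sgraph) : Prop :=
  forall v : G, #|open_nbhd v| = k.

Definition cubic (G : sgraph) : Prop := regular 3 G.

Definition totally_silver_coloring (G : sgraph) (C : Type) (c : G -> C) : Prop :=
  forall (v : G) (k : C), exists! u : G, u \in closed_nbhd v /\ c u = k.

Definition totally_silver (G : sgraph) : Prop :=
  exists (C : Type) (c : G -> C), totally_silver_coloring c.

(* [ucycle] also accepts the empty sequence and a single edge [:: x; y]
   traversed back and forth, hence the bound on the size. *)
Definition is_cycle (G : sgraph) (p : seq G) : Prop :=
  ucycle (@adj G) p /\ 3 <= size p.

Definition has_girth (G : sgraph) (g : nat) : Prop :=
  (exists2 p : seq G, is_cycle p & size p = g) /\
  (forall p : seq G, is_cycle p -> g <= size p).

(* Main.v *)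
Require Import Defs.
From mathcomp Require Import all_boot.
From mathcomp Require Import zify.

(** A cubic totally silver graph of order [4 n] is an [n]-fold cover of [K_4],
    the colour of a vertex being the vertex of [K_4] below it.  We take the cyclic
    cover with voltages 1, 2, 4 on a triangle [0 -> 1 -> 2 -> 0] and voltage 0 on
    the three edges at 3.  A cycle of the cover projects to a closed reduced walk
    of [K_4] whose total voltage vanishes modulo [n].  The closed reduced walks
    of length 3 to 8 have nonzero integral voltage of absolute value at most 14,
    so for [n >= 15] there is no cycle shorter than 9, whereas
    some closed walk of length 9 has integral voltage 0. *)

Set Implicit Arguments.
Unset Strict Implicit.
Unset Printing Implicit Defensive.

Section Nonbacktracking.
Variable T : eqType.

Fixpoint nonbacktracking (s : seq T) : bool :=
  if s is a :: s' then
    (if s' is _ :: c :: _ then a != c else true) && nonbacktracking s'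
  else true.

Lemma uniq_nonbacktracking (s : seq T) : uniq s -> nonbacktracking s.
Proof.
elim: s => //= a s IHs /andP[nas us]; rewrite IHs // andbT.
by case: s nas {us IHs} => [|b [|c s]] //; rewrite !inE !negb_or => /and3P[].
Qed.

(** Triples after the first lie in [rcons q x], a rotation of [x :: q] and hence duplicate-free. The
    turn at [x] itself is not tested. *)
Lemma uniq_closed_nonbacktracking (x : T) (q : seq T) :
  uniq (x :: q) -> 1 < size q -> nonbacktracking (x :: rcons q x).
Proof.
case: q => [|y [|z q]] // uq _.
have xz : x != z by move: uq; rewrite /= !inE !negb_or => /andP[/and3P[]].
rewrite [nonbacktracking _]/= xz; apply: (@uniq_nonbacktracking [:: y, z & rcons q x]).
by rewrite -!rcons_cons rcons_uniq -cons_uniq.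
Qed.

End Nonbacktracking.

Definition volt (a b : nat) : nat :=
  match a, b with 0, 1 => 1 | 1, 2 => 2 | 2, 0 => 4 | _, _ => 0 end.

Lemma volt_le4 a b : volt a b <= 4.
Proof. by case: a b => [|[|[|a]]] [|[|[|b]]]. Qed.

(* The integral voltage of a walk is [walk_fwd - walk_bwd]; the two parts are
   kept apart to stay in [nat]. *)
Fixpoint walk_fwd (a : nat) (w : seq nat) : nat :=
  if w is b :: w' then volt a b + walk_fwd b w' else 0.

Fixpoint walk_bwd (a : nat) (w : seq nat) : nat :=
  if w is b :: w' then volt b a + walk_bwd b w' else 0.

Fixpoint words (m k : nat) : seq (seq nat) :=
  if k is k'.+1 then [seq a :: w | a <- iota 0 m, w <- words m k'] else [:: [::]].

Lemma mem_words m w : all (fun a => a < m) w -> w \in words m (size w).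
Proof.
elim: w => //= a w IHw /andP[ltam /IHw ww].
by apply: allpairs_f; rewrite // mem_iota.
Qed.

Definition walk_ok (a : nat) (w : seq nat) : bool :=
  let f := walk_fwd a (rcons w a) in let b := walk_bwd a (rcons w a) in
  [&& f != b, f < b + 15 & b < f + 15].

Definition short_walks_ok (k : nat) : bool :=
  all (fun s => if s is a :: w then
      (path (fun x y => x != y) a (rcons w a) && nonbacktracking (a :: rcons w a))
        ==> walk_ok a w
    else true) (words 4 k).

(** Exhaustive evaluation over the 87360 words of length 3 to 8 on four letters. *)
Lemma short_walks_okP : all short_walks_ok (iota 3 6).
Proof. by vm_compute. Qed.

Lemma reduced_short_walk_ok a w :
  all (fun b => b < 4) (a :: w) -> 2 <= size w < 8 ->
  path (fun x y => x != y) a (rcons w a) -> nonbacktracking (a :: rcons w a) ->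
  walk_ok a w.
Proof.
move=> lt4 szw pw nw.
have := allP short_walks_okP (size w).+1; rewrite mem_iota => /(_ ltac:(lia)).
by move/allP => /(_ (a :: w) (mem_words lt4)); rewrite pw nw.
Qed.

Section Cover.
Variable n : nat.

Definition cover_vertex : finType := ('I_4 * 'I_n)%type.

(** Subtraction-free form of [v.2 = u.2 + volt u.1 v.1 - volt v.1 u.1] modulo [n]; swapping [u] and
    [v] only swaps the two sides. *)
Definition cover_adj : rel cover_vertex := fun u v =>
  (u.1 != v.1) && (u.2 + volt u.1 v.1 == v.2 + volt v.1 u.1 %[mod n]).

Lemma cover_adj_sym : symmetric cover_adj.
Proof. by move=> u v; rewrite /cover_adj eq_sym; congr (_ && _); rewrite eq_sym. Qed.

Lemma cover_adj_irrefl : irreflexive cover_adj.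
Proof. by move=> u; rewrite /cover_adj eqxx. Qed.

Definition cover : sgraph := SGraph cover_adj_sym cover_adj_irrefl.

(** Edges lift uniquely: the fibre of the endpoint fixes both voltages, so its index is determined
    modulo [n]. *)
Lemma cover_adj_inj (u v w : cover) :
  adj u v -> adj u w -> v.1 = w.1 -> v = w.
Proof.
case: u v w => [a i] [b j] [c k] /= /andP[_ /eqP uv] /andP[_ /eqP uw] bc.
move: uv uw; rewrite /= -{c}bc => -> /eqP; rewrite eqn_modDr.
by rewrite !modn_small // => /eqP/val_inj ->.
Qed.

Hypothesis n15 : 15 <= n.

Lemma cover_nbr_exists (u : cover) (b : 'I_4) :
  b != u.1 -> exists2 v : cover, adj u v & v.1 = b.
Proof.
move=> bu; have n_gt0 : 0 < n by lia.
(* Solves the adjacency congruence for the index over [b]; the added [n] keeps the subtraction from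
   truncating, as voltages are at most 4. *)
pose j := u.2 + volt u.1 b + (n - volt b u.1).
exists (b, Ordinal (ltn_pmod j n_gt0)) => //.
rewrite /= /cover_adj /= eq_sym bu /= modnDml /j -addnA subnK ?modnDr //.
by apply: leq_trans (volt_le4 _ _) _; lia.
Qed.

Lemma cover_cubic : cubic cover.
Proof.
move=> u; rewrite -(@card_in_imset _ _ (fun v : cover => v.1)); last first.
  by move=> v w; rewrite !inE; apply: cover_adj_inj.
have -> : [set v.1 | v in open_nbhd u] = [set~ u.1].
  apply/setP=> b; rewrite !inE; apply/imsetP/idP => [[v]|].
    by rewrite inE => /andP[uv _] ->; rewrite eq_sym.
  by case/cover_nbr_exists => v uv <-; exists v; rewrite ?inE.
by rewrite cardsC1 card_ord.
Qed.

Lemma cover_totally_silver : totally_silver cover.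
Proof.
exists 'I_4, (fun v : cover => v.1) => u b.
have [<-|bu] := eqVneq u.1 b.
  exists u; split; first by rewrite !inE eqxx.
  by move=> v [] /[!inE] /orP[/eqP|/andP[/eqP uv _] /esym] //.
have [|v uv vb] := @cover_nbr_exists u b; first by rewrite eq_sym.
exists v; split; first by rewrite !inE uv orbT.
move=> w [] /[!inE] /orP[/eqP -> ub|uw wb]; first by rewrite ub eqxx in bu.
by apply: cover_adj_inj uv uw _; rewrite vb wb.
Qed.

Lemma cover_order : graph_order cover = 4 * n.
Proof. by rewrite /graph_order card_prod !card_ord. Qed.

Definition color (u : cover) : nat := u.1.

Lemma cover_path_voltage (x : cover) (q : seq cover) : path (@adj cover) x q ->
  x.2 + walk_fwd (color x) (map color q)
    = (last x q).2 + walk_bwd (color x) (map color q) %[mod n].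
Proof.
elim: q x => //= y q IHq x /andP[/andP[_ /eqP xy] /IHq yq].
by rewrite addnA -modnDml xy modnDml addnAC -modnDml yq modnDml addnAC addnA.
Qed.

Lemma cover_path_colors (x : cover) (q : seq cover) : path (@adj cover) x q ->
  path (fun a b => a != b) (color x) (map color q).
Proof. by elim: q x => //= y q IHq x /andP[/andP[xy _] /IHq ->]; rewrite andbT. Qed.

(** A backtrack below would give [y] two neighbours of one colour, which unique lifting identifies,
    so the path above would backtrack too. *)
Lemma cover_path_nonbacktracking (x : cover) (q : seq cover) :
  path (@adj cover) x q -> nonbacktracking (x :: q) ->
  nonbacktracking (map color (x :: q)).
Proof.
elim: q x => // y q IHq x /andP[xy yq] /andP[xz nq].
have {}IHq := IHq y yq nq.
rewrite -[nonbacktracking _]/(_ && nonbacktracking (map color (y :: q))) IHq andbT.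
case: q xz yq {IHq nq} => //= z q xz /andP[yz _].
apply: contraNN xz => /eqP/val_inj xz; apply/eqP.
by apply: cover_adj_inj xz; [rewrite adj_sym; exact: xy | exact: yz].
Qed.

Lemma cover_cycle_ge9 (p : seq cover) : is_cycle p -> 9 <= size p.
Proof.
case=> /andP[cp up] szp; rewrite leqNgt; apply/negP => szp9.
case: p cp up szp szp9 => //= x q pq uq szq szq9.
have /and3P[] : walk_ok (color x) (map color q).
  apply: reduced_short_walk_ok.
  - by rewrite -map_cons; apply/allP => _ /mapP[u _ ->]; exact: ltn_ord.
  - by rewrite size_map; apply/andP.
  - by rewrite -map_rcons; exact: cover_path_colors.
  - rewrite -map_rcons -map_cons; apply: cover_path_nonbacktracking => //.
    exact: uniq_closed_nonbacktracking.
(* The walk returns to [x], so the index [x.2] cancels and the voltage vanishes modulo [n]. *)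
have /eqP := cover_path_voltage pq; rewrite last_rcons eqn_modDl map_rcons.
set f := walk_fwd _ _; set b := walk_bwd _ _ => fb /eqP nfb ltfb ltbf.
wlog leq_fb : f b fb nfb ltfb ltbf / f <= b.
  by move=> H; case: (leqP f b) => [|/ltnW] /H; apply=> //; [rewrite eq_sym|move=> /esym].
(* Now [n] divides [b - f], which is positive and below 15. *)
move: fb; rewrite eq_sym eqn_mod_dvd // => /dvdn_leq; lia.
Qed.

Lemma cover_9cycle : exists2 p : seq cover, is_cycle p & size p = 9.
Proof.
(* Lift of the walk 0 1 3 0 1 3 2 1 3 0: triangle 0 1 3 twice, with 3 2 1 3 inserted, of voltage 1 +
   1 - 2 = 0. *)
pose s := [:: (0, 0); (1, 1); (3, 1); (0, 1); (1, 2); (3, 2); (2, 2); (1, 0); (3, 0)].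
have n_gt0 : 0 < n by lia.
pose f (t : nat * nat) : cover := (inord t.1, Ordinal (ltn_pmod t.2 n_gt0)).
pose P (t : nat * nat) := (t.1 < 4) && (t.2 < 15).
have fE t : P t -> (f t).1 = t.1 :> nat /\ (f t).2 = t.2 :> nat.
  by case/andP=> t4 t15; rewrite /= inordK // modn_small //; lia.
have Ps : all P s by [].
exists (map f s) => //; split; last by [].
apply/andP; split; last first.
  rewrite map_inj_in_uniq // => t t' /(allP Ps)/fE[t1 t2] /(allP Ps)/fE[t1' t2'] ff.
  by apply/eqP; rewrite -pair_eqE /= -t1 -t2 -t1' -t2' ff !eqxx.
rewrite cycle_map.
(* Adjacency with equality in [nat] instead of modulo [n]: all steps of [s] satisfy it, so one
   evaluation serves every [n]. *)
pose e t t' := (t.1 != t'.1) && (t.2 + volt t.1 t'.1 == t'.2 + volt t'.1 t.1).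
suff ee' : {in P &, subrel e (relpre f (@adj cover))}.
  exact: (sub_in_cycle ee' Ps).
move=> t t' /fE[t1 t2] /fE[t1' t2'] /andP[tt' /eqP ee].
apply/andP; split; first by rewrite -val_eqE; move: t1 t1' => /= -> ->.
by move: t1 t2 t1' t2' => /= -> -> -> ->; rewrite ee.
Qed.

End Cover.

Theorem theorem5p1 (n : nat) (hn : 15 <= n) :
  exists G : sgraph,
    [/\ cubic G, totally_silver G, graph_order G = 4 * n & has_girth G 9].
Proof.
exists (cover n); split.
- exact: cover_cubic.
- exact: cover_totally_silver.
- exact: cover_order.
- by split; [exact: cover_9cycle | exact: cover_cycle_ge9].
Qed.
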